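(* Let $(A,\Sigma)$ be a trimmed signed system with $A\in(\mathbb R\cup\{\infty\})^{n\times d}$. Then the procedure FindWitness described in the context, applied to $(A,\Sigma)$, terminates and computes a covector graph $\mathcal C_A(N,D\cup\{\delta\})$ which certifies the feasibility or infeasibility of $(A,\Sigma)$: if it returns ''feasible'', then the returned point $A[N|D\cup\{\delta\}]$ is a feasible point of $(A,\Sigma)$ (and $(A,\Sigma)$ is feasible), and if it returns ''infeasible'', then $(A,\Sigma)$ is infeasible.
   Context: Let $\mathbb T_{\min}=\mathbb R\cup\{\infty\}$ and $[m]=\{1,\dots,m\}$; minima over empty sets are $\infty$. A signed system is a pair $(A,\Sigma)$ with $A=(a_{ji})\in\mathbb T_{\min}^{n\times d}$, $\Sigma=(\sigma_{ji})\in\{+,-,\bullet\}^{n\times d}$ and $a_{ji}=\infty\Leftrightarrow\sigma_{ji}=\bullet$. A point $x\in\mathbb T_{\min}^d$ is feasible if $\min_{i:\sigma_{ji}=+}(a_{ji}+x_i)\le\min_{i:\sigma_{ji}=-}(a_{ji}+x_i)$ for all $j\in[n]$. The system is feasible if it has a feasible point in $\mathbb T_{\min}^d\setminus\{(\infty,\dots,\infty)\}$, otherwise infeasible. It is trimmed if each row of $\Sigma$ contains at most one entry $-$. The generalized covector graph $G_A(x)$ of $x\in\mathbb T_{\min}^d$ is the bipartite graph on $[d]\sqcup[n]$ with an edge $(i,j)\in[d]\times[n]$ iff $a_{ji}+x_i=\min\{a_{jk}+x_k\mid x_k\ne\infty,\ a_{jk}\ne\infty\}\ne\infty$. Nodes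 in $[d]$ are coordinate nodes, nodes in $[n]$ apex nodes; the edge $(i,j)$ is negative if $\sigma_{ji}=-$ and positive if $\sigma_{ji}=+$. An apex $j$ has shape $i$ if $\sigma_{ji}=-$. For a square matrix $B$ over $\mathbb T_{\min}$ with rows indexed by $J$ and columns by $K$, $\operatorname{tdet}(B)=\min_{\pi}\sum_{j\in J}b_{j\pi(j)}$ over all bijections $\pi:J\to K$, with $\operatorname{tdet}$ of the empty matrix equal to $0$. For $I\subseteq[d]$, $J\subseteq[n]$ with $|J|=|I|-1$, the tropical Cramer solution $A[J|I]\in\mathbb T_{\min}^d$ has $A[J|I]_i=\operatorname{tdet}(A_{J,I\setminus\{i\}})$ for $i\in I$ and $A[J|I]_i=\infty$ otherwise; $\mathcal C_A(J,I)=G_A(A[J|I])$. Procedure FindWitness$(A,\Sigma)$: choose $\delta\in[d]$, set $D=N=\emptyset$ and $y=\mathcal C_A(N,D\cup\{\delta\})$. Repeat (outer loop): (a) (inner while-loop) while there is an apex $r\in[n]\setminus N$ of degree $1$ in $y$ incident to $D$ via a negative edge: choose such an $r$, let $p\in N$ be the element of $N$ of the same shape as $r$, replace $N$ by $(N\setminus\{p\})\cup\{r\}$ and $y$ by $\mathcal C_A(N,D\cup\{\delta\})$; (b) if $\delta$ is not incident in $y$ with an apex node of degree $1$ via a negative edge, return (''feasible'', $A[N|D\cup\{\delta\}]$); (c) otherwise, if $|D|=d-1$, return (''infeasible'', $A[N|D\cup\{\delta\}]$); (d) otherwise let $j\in[n]\setminus N$ be an apex of degree $1$ in $y$ incident with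 $\delta$ via a negative edge, replace $N$ by $N\cup\{j\}$, $D$ by $D\cup\{\delta\}$, $\delta$ by any element of $[d]\setminus D$ (new $D$), and $y$ by $\mathcal C_A(N,D\cup\{\delta\})$. *)

(* Defs.v *)
From HB Require Import structures.
From mathcomp Require Import all_boot all_order all_algebra.
From mathcomp Require Import constructive_ereal reals.

Set Implicit Arguments.
Unset Strict Implicit.
Unset Printing Implicit Defensive.

Import Order.TTheory GRing.Theory Num.Theory.

Local Open Scope ring_scope.
Local Open Scope ereal_scope.

Variant sign := Pos | Neg | Bullet.

Definition sign_to_option (s : sign) : option bool :=
  match s with Pos => Some true | Neg => Some false | Bullet => None end.

Definition option_to_sign (o : option bool) : sign :=
  match o with Some true => Pos | Some false => Neg | None => Bullet end.

Lemma sign_to_optionK : cancel sign_to_option option_to_sign.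
Proof. by case. Qed.

HB.instance Definition _ := Equality.copy sign (can_type sign_to_optionK).

Variant verdict := Feasible | Infeasible.

(* Tropical numbers are the elements of [\bar R] other than [-oo]. *)
Definition tropical_mx (R : realType) (n d : nat) (B : 'M[\bar R]_(n, d)) :
    Prop :=
  forall j i, B j i != -oo.

Section SignedSystem.
Context (R : realType) (n d : nat).
Context (A : 'M[\bar R]_(n, d)) (Sigma : 'M[sign]_(n, d)).

Definition signed_system : Prop :=
  tropical_mx A /\ forall j i, A j i = +oo <-> Sigma j i = Bullet.

Definition trimmed : Prop :=
  forall j, (#|[set i | Sigma j i == Neg]| <= 1)%N.

Definition feasible_point (x : 'rV[\bar R]_d) : Prop :=
  tropical_mx x /\
  forall j,
    \big[mine/+oo]_(i | Sigma j i == Pos) (A j i + x ord0 i) <=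
    \big[mine/+oo]_(i | Sigma j i == Neg) (A j i + x ord0 i).

Definition feasible : Prop :=
  exists x : 'rV[\bar R]_d, x != const_mx +oo /\ feasible_point x.

Definition infeasible : Prop := ~ feasible.

Definition row_min (x : 'rV[\bar R]_d) (j : 'I_n) : \bar R :=
  \big[mine/+oo]_(k | (x ord0 k != +oo) && (A j k != +oo)) (A j k + x ord0 k).

(* An edge is a pair (coordinate node, apex node). *)
Definition covector (x : 'rV[\bar R]_d) : {set 'I_d * 'I_n} :=
  [set e | (A e.2 e.1 + x ord0 e.1 == row_min x e.2) &&
           (row_min x e.2 != +oo)].

Definition apex_degree (y : {set 'I_d * 'I_n}) (j : 'I_n) : nat :=
  #|[set i | (i, j) \in y]|.

(* The minimum is +oo if J and K have different cardinalities. *)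
Definition tdet (J K : finType) (B : J -> K -> \bar R) : \bar R :=
  \big[mine/+oo]_(f : {ffun J -> K} |
      injectiveb f && [forall k, k \in codom f]) \sum_(j : J) B j (f j).

Definition sub_tdet (J : {set 'I_n}) (K : {set 'I_d}) : \bar R :=
  tdet (fun (j : {j : 'I_n | j \in J}) (k : {k : 'I_d | k \in K}) =>
          A (val j) (val k)).

(* Only meaningful when #|J|.+1 = #|I|. *)
Definition cramer (J : {set 'I_n}) (I : {set 'I_d}) : 'rV[\bar R]_d :=
  \row_i (if i \in I then sub_tdet J (I :\ i) else +oo).

Definition cramer_covector (J : {set 'I_n}) (I : {set 'I_d}) :
    {set 'I_d * 'I_n} :=
  covector (cramer J I).

Definition has_shape (j : 'I_n) (i : 'I_d) : bool := Sigma j i == Neg.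

Definition same_shape (p r : 'I_n) : bool :=
  [exists i, has_shape p i && has_shape r i].

Definition neg_leaf (y : {set 'I_d * 'I_n}) (i : 'I_d) (r : 'I_n) : bool :=
  [&& apex_degree y r == 1%N, (i, r) \in y & Sigma r i == Neg].

Definition pivot_apex (D : {set 'I_d}) (N : {set 'I_n})
    (y : {set 'I_d * 'I_n}) (r : 'I_n) : bool :=
  (r \notin N) && [exists i in D, neg_leaf y i r].

Definition blocked (delta : 'I_d) (y : {set 'I_d * 'I_n}) : bool :=
  [exists j, neg_leaf y delta j].

Inductive state :=
| Running (D : {set 'I_d}) (N : {set 'I_n}) (delta : 'I_d)
    (y : {set 'I_d * 'I_n})
| Returned (v : verdict) (x : 'rV[\bar R]_d).

Definition start (delta : 'I_d) : state :=
  Running set0 set0 delta (cramer_covector set0 (delta |: set0)).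

(* FindWitness as a nondeterministic transition relation: every choice made by
   the procedure is a transition.  In [step_pivot], p is required to be the
   unique apex of N with the shape of r, so a state in which it is missing or
   ambiguous has no such transition. *)
Inductive step : state -> state -> Prop :=
| step_pivot D N delta y r p :
    pivot_apex D N y r ->
    [set q in N | same_shape q r] = [set p] ->
    step (Running D N delta y)
         (Running D (r |: (N :\ p)) delta
            (cramer_covector (r |: (N :\ p)) (delta |: D)))
| step_feasible D N delta y :
    (forall r, ~~ pivot_apex D N y r) ->
    ~~ blocked delta y ->
    step (Running D N delta y) (Returned Feasible (cramer N (delta |: D)))
| step_infeasible D N delta y :
    (forall r, ~~ pivot_apex D N y r) ->
    blocked delta y ->
    #|D|.+1 = d ->
    step (Running D N delta y) (Returned Infeasible (cramer N (delta |: D)))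
| step_grow D N delta y j delta' :
    (forall r, ~~ pivot_apex D N y r) ->
    blocked delta y ->
    #|D|.+1 <> d ->
    j \notin N ->
    neg_leaf y delta j ->
    delta' \notin delta |: D ->
    step (Running D N delta y)
         (Running (delta |: D) (j |: N) delta'
            (cramer_covector (j |: N) (delta' |: (delta |: D)))).

Inductive reachable : state -> Prop :=
| reachable_start delta : reachable (start delta)
| reachable_step s t : reachable s -> step s t -> reachable t.

Definition terminates_from (s : state) : Prop :=
  Acc (fun t s' => step s' t) s.

End SignedSystem.

(* Main.v *)
Require Import Defs.
From mathcomp Require Import all_boot all_order all_algebra.
From mathcomp Require Import constructive_ereal reals.
From mathcomp Require Import ring lra.

(** FindWitness is a strategy iteration for shortest paths.  Each apex [j] of [N]
    is chosen by its shape [sh j], and the shapes of [N] are exactly [D].  Regard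
    [j] as a bundle of arcs [sh j -> k] of length [A j k - A j (sh j)].  As long
    as all cycles have positive length, the Cramer solution of [N] on
    [delta |: D] is, up to a constant, the vector of distances to [delta].

    No genericity of [A] is assumed, so positivity of the cycles has to be an
    invariant of the run.  It is expressed through a strict potential, a real
    vector [u] with [A j (sh j) + u (sh j) < A j k + u k] for all [j] in [N] and
    [k != sh j] (the predicate [sharp]).  An exchange argument on matchings shows
    that each row of [N] that is finite at its shape for the Cramer solution [y]
    also has a minimiser off its shape ([cramer_tight]).  The strictness of [u]
    makes these tight arcs acyclic, and this gives the triangle inequality for
    [y] ([cramer_potential]).

    An apex with a negative edge of degree one is a row that is strict at [y].
    Mixing [y] with a small multiple of [u] yields a strict potential for [N]
    together with this apex ([sharp_setU1]), so both the exchange of an apex and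
    the enlargement of [D] preserve the invariant.  In an exchange the old [y]
    remains a potential, and it is strict at the entering apex; distances are the
    greatest potentials ([cramer_greatest]), so [y - y delta] increases and no
    set [N] recurs before [D] grows.

    If there is no negative edge of degree one left, every row holds, for a
    violated row has its negative entry as unique minimiser
    ([no_neg_leaf_feasible]).  If all coordinates have a selected apex, a feasible
    point would contradict a strict potential at the coordinate where their
    difference is largest ([sharp_infeasible]). *)

Section FindWitness.
Set Implicit Arguments.
Unset Strict Implicit.
Unset Printing Implicit Defensive.
Import Order.TTheory GRing.Theory Num.Theory.
Local Open Scope ring_scope.
Local Open Scope ereal_scope.

(** * Extended reals and finite minima *)

Lemma tropE (R : realType) (x : \bar R) :
  x != -oo -> x != +oo -> x = (fine x)%:E.
Proof. by case: x. Qed.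

Lemma bigmin_ooP (R : realType) (I : finType) (P : pred I) (F : I -> \bar R) :
  \big[mine/+oo]_(i | P i) F i = +oo \/
  exists2 i, P i & \big[mine/+oo]_(i | P i) F i = F i.
Proof.
case: (pickP P) => [i Pi|P0]; last by left; rewrite big_pred0.
right; have [k Pk ->] := eq_bigmin i P F Pi (fun k _ => leey (F k)).
by exists k.
Qed.

Lemma ler_norm_sum (R : realType) (I : finType) (F : I -> R) (i : I) :
  (F i <= \sum_k `|F k|)%R.
Proof.
rewrite (bigD1 i) //=; apply: le_trans (ler_norm _) _.
by rewrite lerDl sumr_ge0.
Qed.

(** * Tropical determinants as minima over matchings *)

Section Matchings.
Context (R : realType) (n d : nat) (A : 'M[\bar R]_(n, d)).
Hypothesis A_trop : tropical_mx A.

(** The bijections from [J] to [K] as restrictions of total maps on rows, so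
    that one row can be reassigned without leaving the type. *)
Definition matches (J : {set 'I_n}) (K : {set 'I_d}) (h : 'I_n -> 'I_d) :=
  {in J &, injective h} /\ h @: J = K.

Lemma sub_tdet_le J K h :
  matches J K h -> sub_tdet A J K <= \sum_(j in J) A j (h j).
Proof.
move=> [h_inj hJ].
have hK (j : {j | j \in J}) : h (val j) \in K by rewrite -hJ imset_f ?(valP j).
pose f : {ffun {j | j \in J} -> {k | k \in K}} :=
  [ffun j => Sub (h (val j)) (hK j)].
rewrite (@big_sub _ _ _ _ (mem J) (fun j => A j (h j))).
rewrite (eq_bigr (fun j => A (val j) (val (f j)))); last first.
  by move=> j _; rewrite ffunE.
rewrite /sub_tdet /tdet; apply: (@bigmin_le_cond _ _ _ _ f); apply/andP; split.
  apply/injectiveP => j1 j2; rewrite !ffunE => /(congr1 val) /= e.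
  by apply/val_inj/h_inj; rewrite ?(valP j1) ?(valP j2).
have kJ k : k \in K -> k \in h @: J by rewrite hJ.
apply/forallP => k; have /imsetP[j jJ ek] := kJ _ (valP k).
apply/codomP; exists (Sub j jJ); apply: val_inj; rewrite ffunE /= ek //.
Qed.

Lemma sub_tdetP (i0 : 'I_d) J K : sub_tdet A J K = +oo \/
  exists2 h, matches J K h & sub_tdet A J K = \sum_(j in J) A j (h j).
Proof.
rewrite /sub_tdet /tdet.
set P := (X in \big[_/_]_(f | X f) _); set F := (X in \big[_/_]_(f | _) X f).
case: (bigmin_ooP P F) => [->|[f Pf ->]]; [by left | right].
case/andP: Pf => /injectiveP f_inj /forallP f_surj.
pose h j := if insub j is Some j' then val (f j') else i0.
have hE (j : {j | j \in J}) : h (val j) = val (f j) by rewrite /h valK.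
exists h; last first.
  rewrite (@big_sub _ _ _ _ (mem J) (fun j => A j (h j))).
  by apply: eq_bigr => j _; rewrite hE.
split=> [j1 j2 j1J j2J|].
  by rewrite (hE (Sub j1 j1J)) (hE (Sub j2 j2J)) => /val_inj/f_inj/(congr1 val).
apply/setP => k; apply/imsetP/idP => [[j jJ ->]|kK].
  by rewrite (hE (Sub j jJ)) (valP (f _)).
have /codomP[j ej] := f_surj (Sub k kK).
by exists (val j); [exact: valP | rewrite hE -ej].
Qed.

Lemma sub_tdet_trop (i0 : 'I_d) J K : sub_tdet A J K != -oo.
Proof.
have [->//|[h _ ->]] := sub_tdetP i0 J K.
by elim/big_ind: _ => // x y; rewrite adde_eq_ninfty negb_or => -> ->.
Qed.

(** Exchange: moving row [j] to the column [i] that was left out frees the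
    column [h j] that it occupied. *)
Lemma matches_update J I h i j : matches J (I :\ i) h -> i \in I -> j \in J ->
  matches J (I :\ h j) [eta h with j |-> i].
Proof.
move=> [h_inj hJ] iI jJ.
have hJi k : k \in J -> h k != i /\ h k \in I.
  by move=> kJ; have := imset_f h kJ; rewrite hJ !inE => /andP[].
split=> [a b aJ bJ /=|].
  case: eqVneq => [->|aj]; case: eqVneq => [->|bj] //.
  - by move=> e; have [] := hJi b bJ; rewrite -e eqxx.
  - by move=> e; have [] := hJi a aJ; rewrite e eqxx.
  - exact: h_inj.
apply/setP => k; rewrite !inE; apply/imsetP/andP => [[a aJ /= ->]|[kj kI]].
  case: (eqVneq a j) => [_|aj]; split=> //.
  - by rewrite eq_sym; case: (hJi j jJ).
  - by apply: contra_neq aj => /(h_inj _ _ aJ jJ).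
  - by case: (hJi a aJ).
case: (eqVneq k i) => [->|ki]; first by exists j => //=; rewrite eqxx.
have : k \in h @: J by rewrite hJ !inE ki.
case/imsetP=> a aJ ka; exists a => //=; case: eqVneq => // aj.
by rewrite ka aj eqxx in kj.
Qed.

Lemma sum_update (J : {set 'I_n}) (h : 'I_n -> 'I_d) i j : j \in J ->
  (\sum_(m in J) A m ([eta h with j |-> i] m)) + A j (h j) =
  (\sum_(m in J) A m (h m)) + A j i.
Proof.
move=> jJ; rewrite [in LHS](bigD1 j) //= eqxx [in RHS](bigD1 j) //=.
under eq_bigr => m /andP[_ /negPf mj] do rewrite mj.
by rewrite addeAC [RHS]addeC addeA.
Qed.

End Matchings.

(** * Cramer solutions as distances *)

Section Cramer.
Context (R : realType) (n d : nat) (A : 'M[\bar R]_(n, d)).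
Hypothesis A_trop : tropical_mx A.
Context (sh : 'I_n -> 'I_d).

(** A potential [u] at which every apex of [N] has its own shape as its only
    minimiser.  When the entries [A j (sh j)] are finite, such a [u] exists
    exactly if every cycle of the digraph with arcs [sh j -> k] of length
    [A j k - A j (sh j)], for [k != sh j], has positive length. *)
Definition sharp (N : {set 'I_n}) (u : 'I_d -> R) := forall j k,
  j \in N -> k != sh j -> A j (sh j) + (u (sh j))%:E < A j k + (u k)%:E.

Context (N : {set 'I_n}) (delta : 'I_d).
Hypotheses (sh_inj : {in N &, injective sh}) (delta_sh : delta \notin sh @: N).
Hypothesis diag_fin : forall j, j \in N -> A j (sh j) != +oo.

Let E := delta |: sh @: N.
Let y i := cramer A N E ord0 i.

Lemma cramer_trop i : y i != -oo.
Proof. by rewrite /y mxE; case: ifP => // _; apply: sub_tdet_trop. Qed.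

Lemma cramerP i : y i != +oo ->
  i \in E /\ exists2 h, matches N (E :\ i) h & y i = \sum_(j in N) A j (h j).
Proof.
rewrite /y mxE; case: ifP => [iE|_]; last by rewrite eqxx.
case: (sub_tdetP A i N (E :\ i)) => [->|[h hm ->] _]; first by rewrite eqxx.
by split=> //; exists h.
Qed.

Lemma cramer_le i h : i \in E -> matches N (E :\ i) h ->
  y i <= \sum_(j in N) A j (h j).
Proof. by move=> iE hm; rewrite /y mxE iE sub_tdet_le. Qed.

Lemma matches_shape : matches N (E :\ delta) sh.
Proof. by split=> //; rewrite setU1K. Qed.

Lemma cramer_exchange i h j : i \in E -> matches N (E :\ i) h -> j \in N ->
  A j (h j) + y (h j) <= A j i + \sum_(m in N) A m (h m).
Proof.
move=> iE hm jN; have hjE : h j \in E.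
  by have := imset_f h jN; rewrite (hm.2) !inE => /andP[_ ->].
rewrite [leRHS]addeC -(sum_update A h i jN) addeC leeD2r //.
exact: cramer_le hjE (matches_update hm iE jN).
Qed.

(** In a best matching that leaves out [sh j], the apex [j] must go to another
    column [k]; exchanging the two shows that row [j] is no larger at [k]
    than at its shape. *)
Lemma cramer_tight j : j \in N -> y (sh j) != +oo ->
  exists2 k, k != sh j & A j k + y k <= A j (sh j) + y (sh j).
Proof.
move=> jN /cramerP[shjE [h hm yE]].
exists (h j); last by rewrite yE cramer_exchange.
by have := imset_f h jN; rewrite (hm.2) !inE => /andP[].
Qed.

Section Potential.
Context (u : 'I_d -> R).
Hypothesis u_sharp : sharp N u.

(* [y] may be infinite, and such coordinates get the least value of [v]. *)
Let v i := (u i)%:E - y i.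

(** Weak duality: along any bijection onto the shapes the values of [u] cancel,
    so sharpness makes the shape matching optimal. *)
Lemma sum_diag_le h : matches N (E :\ delta) h ->
  \sum_(j in N) A j (sh j) <= \sum_(j in N) A j (h j).
Proof.
move=> [h_inj hN].
have uE : \sum_(j in N) (u (sh j))%:E = \sum_(j in N) (u (h j))%:E.
  rewrite -(big_imset (fun i => (u i)%:E) h_inj) /= hN -matches_shape.2.
  by rewrite (big_imset (fun i => (u i)%:E) sh_inj).
have ufin : \sum_(j in N) (u (sh j))%:E \is a fin_num by rewrite sumEFin.
rewrite -(leeD2rE _ _ ufin) {2}uE -!big_split /=; apply: lee_sum => j jN.
by case: (eqVneq (h j) (sh j)) => [->//|hj]; apply/ltW/u_sharp.
Qed.

Lemma cramer_deltaE : y delta = \sum_(j in N) A j (sh j).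
Proof.
have dE : delta \in E by rewrite !inE eqxx.
apply/eqP; rewrite eq_le (cramer_le dE matches_shape) /=.
case: (eqVneq (y delta) +oo) => [->|/cramerP[_ [h hm ->]]]; first exact: leey.
exact: sum_diag_le.
Qed.

Lemma cramer_delta_fin : y delta != +oo.
Proof.
by rewrite cramer_deltaE; elim/big_ind: _ => // -[x| |] [z| |].
Qed.

(** Tight arcs raise [v], because [u] is sharp: they never close a cycle. *)
Lemma cramer_tightP j : j \in N -> y (sh j) != +oo -> exists k,
  [/\ k != sh j, A j k != +oo, y k != +oo,
      A j k + y k <= A j (sh j) + y (sh j) & v (sh j) < v k].
Proof.
move=> jN yfin; have [k kj le_k] := cramer_tight jN yfin; exists k.
have := u_sharp jN kj; have := A_trop j k; have := A_trop j (sh j).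
have := cramer_trop k; have := cramer_trop (sh j); have := diag_fin jN.
move: le_k yfin; rewrite /v.
case: (A j k) => [a| |]; case: (A j (sh j)) => [b| |] //;
  case: (y k) => [p| |]; case: (y (sh j)) => [q| |] //.
rewrite -!EFinD !lee_fin !lte_fin /= => *; split=> //; lra.
Qed.

(** Induction along tight arcs: since [v] increases, following them from any
    finite coordinate must end at [delta], the only one without an apex. *)
Lemma cramer_walk (P : 'I_d -> Prop) : P delta ->
    (forall j k, j \in N -> k != sh j -> A j k != +oo -> y k != +oo ->
      A j k + y k <= A j (sh j) + y (sh j) -> v (sh j) < v k ->
      P k -> P (sh j)) ->
  forall i, y i != +oo -> P i.
Proof.
move=> P0 PS i; have [m] := ubnP #|[set k | v i < v k]|.
elim: m i => // m IH i le_m yi; have [iE _] := cramerP yi.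
move: iE; rewrite !inE => /predU1P[->//|/imsetP[j jN ij]]; subst i.
have [k [kj Ak yk le_k lt_v]] := cramer_tightP jN yi.
apply: (PS j k) => //; apply: IH => //.
rewrite ltnS in le_m; apply: leq_trans (proper_card _) le_m.
apply/properP; split.
  by apply/subsetP => l; rewrite !inE => /(lt_trans lt_v).
by exists k; rewrite !inE ?ltxx.
Qed.

(** Walking from [i] to [delta] along tight arcs and leaving all other apices
    on their shapes gives a best matching for [i].  The walk only climbs in
    [v], so every apex whose shape lies lower keeps its shape. *)
Lemma cramer_acyclic_matching i : y i != +oo ->
  exists h, [/\ matches N (E :\ i) h, \sum_(j in N) A j (h j) <= y i &
    forall j, j \in N -> v (sh j) < v i -> h j = sh j].
Proof.
move: i; apply: cramer_walk => [|j k jN kj Ak yk le_k lt_v [h [hm le_h h_sh]]].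
  exists sh; split=> //; first exact: matches_shape.
  by rewrite cramer_deltaE.
have [kE _] := cramerP yk; have hj := h_sh j jN lt_v.
exists [eta h with j |-> k]; split.
- by rewrite -hj; apply: matches_update.
- rewrite -(@leeD2lE _ (A j (sh j))); last by rewrite fin_numE A_trop diag_fin.
  rewrite addeC -{1}hj sum_update // addeC; apply: le_trans le_k.
  exact: leeD2l.
- move=> l lN lt_l /=; case: eqVneq => [lj|_]; first by rewrite lj ltxx in lt_l.
  exact: h_sh lN (lt_trans lt_l lt_v).
Qed.

(** The entries of the Cramer solution obey the triangle inequality of
    distances to [delta].  If [sh j] is lower than [k] for [v], the best
    matching for [k] leaves [j] on its shape and [j] can be moved to [k];
    otherwise comparing [v] with the sharpness of [u] is enough. *)
Lemma cramer_potential j k : j \in N ->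
  A j (sh j) + y (sh j) <= A j k + y k.
Proof.
move=> jN; case: (eqVneq k (sh j)) => [->//|kj].
case: (eqVneq (y k) +oo) => [->|yk]; first by rewrite addey ?leey.
case: (eqVneq (A j k) +oo) => [->|Ak]; first by rewrite addye ?leey ?cramer_trop.
have [h [hm le_h h_sh]] := cramer_acyclic_matching yk.
have [kE _] := cramerP yk.
case: (ltP (v (sh j)) (v k)) => [/(h_sh j jN) hj|].
  by rewrite -hj; apply: le_trans (cramer_exchange kE hm jN) _; apply: leeD2l.
have := u_sharp jN kj; have := A_trop j k; have := A_trop j (sh j).
have := cramer_trop k; have := cramer_trop (sh j); have := diag_fin jN.
move: yk Ak; rewrite /v.
case: (A j k) => [a| |]; case: (A j (sh j)) => [b| |] //;
  case: (y k) => [p| |]; case: (y (sh j)) => [q| |] //;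
  rewrite -?EFinD ?lee_fin ?lte_fin //= => *; lra.
Qed.

End Potential.
End Cramer.

(** * Comparison and mixing of potentials *)

Section Comparison.
Context (R : realType) (n d : nat) (A : 'M[\bar R]_(n, d)).
Hypothesis A_trop : tropical_mx A.
Context (sh : 'I_n -> 'I_d) (N : {set 'I_n}) (delta : 'I_d).
Hypotheses (sh_inj : {in N &, injective sh}) (delta_sh : delta \notin sh @: N).
Hypothesis diag_fin : forall j, j \in N -> A j (sh j) != +oo.
Context (u : 'I_d -> R).
Hypothesis u_sharp : sharp A sh N u.
Let y i := cramer A N (delta |: sh @: N) ord0 i.

Context (z : 'I_d -> \bar R).
Hypotheses (z_trop : forall i, z i != -oo) (z_delta : z delta != +oo).
Hypothesis z_pot : forall j k, j \in N -> A j (sh j) + z (sh j) <= A j k + z k.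

(** Among the potentials of [N], the Cramer solution is the greatest once both
    are normalised at [delta]: along a tight arc the difference to any other
    potential can only shrink. *)
Lemma cramer_greatest i : z i - z delta <= y i - y delta.
Proof.
have ytrop k : y k != -oo by exact: cramer_trop.
have yd : y delta != +oo by exact: cramer_delta_fin u_sharp.
have y_oo x : x <= +oo - y delta by case: (y delta) yd => // *; apply: leey.
have [->//|] := eqVneq (y i) +oo.
move: i; apply: (cramer_walk A_trop diag_fin u_sharp).
  move: (ytrop delta) (z_trop delta) yd z_delta.
  by case: (y delta) => // a; case: (z delta) => // b; rewrite -!EFinB !subrr.
move=> j k jN kj Ak yk; rewrite -!/(y _) => le_k _.
have [->//|yj] := eqVneq (y (sh j)) +oo.
move: (ytrop delta) (z_trop delta) yd z_delta (ytrop k) (ytrop (sh j)) (z_trop k).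
move: (z_trop (sh j)) (A_trop j k) (A_trop j (sh j)) (diag_fin jN).
move: (z_pot k jN) le_k Ak yk yj.
case: (y delta) => // a; case: (z delta) => // b.
case: (A j k) => // Ak; case: (A j (sh j)) => // Aj.
case: (y k) => [yk| |] //; case: (y (sh j)) => [yj| |] //;
  case: (z k) => [zk| |] //; case: (z (sh j)) => [zj| |] //;
  by rewrite -?EFinB -?EFinD ?lee_fin //= => *; lra.
Qed.

Lemma cramer_greatest_lt j : j \in N -> z (sh j) != +oo ->
    (forall k, k != sh j -> A j (sh j) + z (sh j) < A j k + z k) ->
  z (sh j) - z delta < y (sh j) - y delta.
Proof.
move=> jN zj zlt.
have ytrop k : y k != -oo by exact: cramer_trop.
have yd : y delta != +oo by exact: cramer_delta_fin u_sharp.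
have [yj|yj] := eqVneq (y (sh j)) +oo.
  move: yj (ytrop delta) (z_trop delta) yd z_delta zj (z_trop (sh j)) => ->.
  case: (y delta) => // a; case: (z delta) => // b; case: (z (sh j)) => // c *.
  exact: ltey.
have [k [kj Ak yk le_k _]] := cramer_tightP A_trop diag_fin u_sharp jN yj.
move: (cramer_greatest k) (zlt k kj) le_k.
move: (ytrop delta) (z_trop delta) yd z_delta (ytrop k) (ytrop (sh j)) (z_trop k).
move: (z_trop (sh j)) (A_trop j k) (A_trop j (sh j)) (diag_fin jN) Ak yk zj yj.
rewrite -!/(y _).
case: (y delta) => // a; case: (z delta) => // b.
case: (A j k) => // Ak; case: (A j (sh j)) => // Aj.
case: (y k) => [yk| |] //; case: (y (sh j)) => [yj| |] //;
  case: (z k) => [zk| |] //; case: (z (sh j)) => [zj| |] //.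
by rewrite -!EFinB -!EFinD !lee_fin !lte_fin => *; lra.
Qed.
End Comparison.

Section Mixing.
Context (R : realType) (n d : nat) (A : 'M[\bar R]_(n, d)).
Hypothesis A_trop : tropical_mx A.
Context (sh : 'I_n -> 'I_d) (N : {set 'I_n}) (r : 'I_n) (u : 'I_d -> R)
  (y : 'I_d -> \bar R).

(** The new sharp potential is a mixture [mu * (lam * y + u)] where [y] is
    finite: [y] is a weak potential for [N] and strict for [r], while [u] supplies
    strictness on [N] and may violate row [r], which a large weight [lam]
    repairs.  Where [y] is infinite, [u] is kept but raised by a large [M];
    no arc of [N] leads from an infinite coordinate to a finite one. *)
Lemma sharp_setU1 :
    (forall j, j \in r |: N -> A j (sh j) != +oo) ->
    (forall i, y i != -oo) -> sharp A sh N u ->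
    (forall j k, j \in N -> A j (sh j) + y (sh j) <= A j k + y k) ->
    y (sh r) != +oo ->
    (forall k, k != sh r -> A r (sh r) + y (sh r) < A r k + y k) ->
  exists u', sharp A sh (r |: N) u'.
Proof.
move=> diag_fin y_trop u_sharp y_pot yr y_lt.
pose a j k := fine (A j k); pose q k := fine (y k).
(* [w k] is the violation of row [r] by [u], [s k] its slack at [y]. *)
pose w k := (a r (sh r) + u (sh r) - a r k - u k)%R.
pose s k := (a r k + q k - a r (sh r) - q (sh r))%R.
pose lam := (\sum_k `| (`|w k| + 1) / s k|)%R.
have lam_ge0 : (0 <= lam)%R by apply: sumr_ge0.
pose mu := ((1 + lam)^-1)%R.
have mu_gt0 : (0 < mu)%R by rewrite invr_gt0 ltr_wpDr.
have muE x : (x = mu * ((1 + lam) * x))%R.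
  by rewrite mulrA mulVf ?mul1r // gt_eqF // ltr_wpDr.
pose b k := (mu * (lam * q k + u k))%R.
have mix j k : (lam * (a j (sh j) + q (sh j) - a j k - q k)
    + (a j (sh j) + u (sh j) - a j k - u k) < 0 ->
    a j (sh j) + b (sh j) < a j k + b k)%R.
  move=> lt0; rewrite -subr_lt0.
  have -> : (a j (sh j) + b (sh j) - (a j k + b k) =
    mu * (lam * (a j (sh j) + q (sh j) - a j k - q k)
    + (a j (sh j) + u (sh j) - a j k - u k)))%R.
    rewrite /b [in LHS](muE (a j (sh j))) [in LHS](muE (a j k)).
    ring.
  by rewrite pmulr_rlt0.
pose M := (\sum_(jk : 'I_n * 'I_d)
  `|a jk.1 (sh jk.1) + b (sh jk.1) - a jk.1 jk.2 - u jk.2 + 1|)%R.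
have MP j k : (a j (sh j) + b (sh j) < a j k + (M + u k))%R.
  have := @ler_norm_sum _ _ (fun jk : 'I_n * 'I_d =>
    (a jk.1 (sh jk.1) + b (sh jk.1) - a jk.1 jk.2 - u jk.2 + 1)%R) (j, k).
  by rewrite -/M /=; lra.
exists (fun k => if y k == +oo then M + u k else b k)%R => j k jrN kj.
have aE x : A j x != +oo -> A j x = (a j x)%:E by apply: tropE.
have qE x : y x != +oo -> y x = (q x)%:E by apply: tropE.
have /aE Aj := diag_fin j jrN; rewrite Aj.
have [->|/aE Ak] := eqVneq (A j k) +oo; first by rewrite -EFinD ltey.
rewrite Ak -!EFinD lte_fin.
have [jr|jr] := eqVneq j r.
  subst j; rewrite (negPf yr); case: eqVneq => [_|/qE yk]; first exact: MP.
  apply: mix; have := y_lt k kj; rewrite Aj Ak yk (qE _ yr) -!EFinD lte_fin => lt_k.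
  have sk : (0 < s k)%R by rewrite /s; lra.
  have : (w k < lam * s k)%R.
    apply: (@lt_le_trans _ _ (`|w k| + 1)%R).
      by rewrite (le_lt_trans (ler_norm _)) // ltrDl.
    by rewrite -ler_pdivrMr //
      (@ler_norm_sum _ _ (fun k => (`|w k| + 1) / s k)%R).
  by rewrite /s /w; nra.
have jN : j \in N by move: jrN; rewrite !inE (negPf jr).
have := y_pot j k jN; have := u_sharp j k jN kj; rewrite Aj Ak -!EFinD lte_fin.
have [yk|/qE yk] := eqVneq (y k) +oo; have [yj|/qE yj] := eqVneq (y (sh j)) +oo.
- by move=> *; lra.
- by move=> _ _; exact: MP.
- by rewrite yk yj -EFinD.
- rewrite yk yj -!EFinD lee_fin => lt_u le_y; apply: mix.
  have : (lam * (a j (sh j) + q (sh j) - a j k - q k) <= 0)%R.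
    by rewrite mulr_ge0_le0 //; lra.
  by move=> *; lra.
Qed.
End Mixing.

Lemma neg_leafP (R : realType) (n d : nat) (A : 'M[\bar R]_(n, d))
    (Sigma : 'M[sign]_(n, d)) (x : 'rV[\bar R]_d) i r :
    tropical_mx A -> tropical_mx x ->
  neg_leaf Sigma (covector A x) i r <->
  [/\ Sigma r i = Neg, A r i != +oo, x ord0 i != +oo &
     forall k, k != i -> A r i + x ord0 i < A r k + x ord0 k].
Proof.
move=> At xt.
have sum_fin k : (A r k + x ord0 k != +oo) = (x ord0 k != +oo) && (A r k != +oo).
  move: (At r k) (xt ord0 k).
  by case: (A r k) => [a| |]; case: (x ord0 k) => [b| |].
have rmin_le k : row_min A x r <= A r k + x ord0 k.
  have [->|] := eqVneq (A r k + x ord0 k) +oo; first exact: leey.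
  by rewrite sum_fin => xk; apply: bigmin_le_cond.
split.
- case/and3P => /eqP/eqP/cards1P[k kE] ir /eqP Si.
  have : i \in [set i0 | (i0, r) \in covector A x] by rewrite inE.
  rewrite kE inE => /eqP ki; subst k.
  move: ir; rewrite inE /= => /andP[/eqP iE].
  rewrite -iE sum_fin => /andP[xi Ai]; split=> // k ki.
  rewrite lt_neqAle iE rmin_le andbT; apply: contra_neqN ki => /eqP ekr.
  apply/set1P; rewrite -kE !inE /= -ekr eqxx /=.
  by rewrite -iE sum_fin xi.
- case=> Si Ai xi lt_k.
  have iE : row_min A x r = A r i + x ord0 i.
    apply/eqP; rewrite eq_le rmin_le /=; apply/bigmin_geP.
    split=> [|k _]; first exact: leey.
    by have [->//|/lt_k/ltW] := eqVneq k i.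
  rewrite /neg_leaf Si eqxx andbT !inE /= iE eqxx sum_fin xi Ai /= andbT.
  apply/cards1P; exists i; apply/setP => k; rewrite !inE /= iE sum_fin xi Ai andbT.
  have [->|/lt_k] := eqVneq k i; first by rewrite eqxx.
  by rewrite lt_neqAle eq_sym andbT => /andP[/negPf].
Qed.

(** * Certificates of feasibility and infeasibility *)

Section Certificates.
Context (R : realType) (n d : nat) (A : 'M[\bar R]_(n, d))
  (Sigma : 'M[sign]_(n, d)).
Hypothesis sys : signed_system A Sigma.
Context (sh : 'I_n -> 'I_d).
Hypothesis shP : forall j i, Sigma j i = Neg -> sh j = i.

(** If every coordinate is the shape of some apex of [N], a feasible [x] would
    give, for each finite coordinate [i], a finite positive [k] with
    [A j k + x k <= A j i + x i].  Sharpness then yields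
    [u k - x k > u i - x i], which fails at a maximiser of [u - x]. *)
Lemma sharp_infeasible (N : {set 'I_n}) (u : 'I_d -> R) :
    sharp A sh N u -> (forall j, j \in N -> Sigma j (sh j) = Neg) ->
  sh @: N = setT -> infeasible A Sigma.
Proof.
case: sys => A_trop sgn u_sharp neg shT [x [x_nz [x_trop x_feas]]].
have [i0 xi0] : exists i, x ord0 i != +oo.
  apply/existsP; apply: contra_neqT x_nz; rewrite negb_exists => /forallP x_oo.
  by apply/rowP => i; rewrite mxE; apply/eqP; move: (x_oo i); rewrite negbK.
pose v i := (u i - fine (x ord0 i))%R.
have [i xi v_max] := @arg_maxP _ _ _ i0 (fun i => x ord0 i != +oo) v xi0.
have : i \in sh @: N by rewrite shT.
case/imsetP=> j jN ij; have Sj := neg j jN.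
have Aj : A j i != +oo.
  by apply/eqP => /(sgn j i).1; rewrite ij Sj.
have min_le : \big[mine/+oo]_(i | Sigma j i == Neg) (A j i + x ord0 i) <=
    A j i + x ord0 i.
  by apply: bigmin_le_cond; rewrite ij Sj.
have := le_trans (x_feas j) min_le.
have [->|[k Sk ->] le_k] :=
  bigmin_ooP (fun i => Sigma j i == Pos) (fun i => A j i + x ord0 i).
  move: (A_trop j i) Aj xi (x_trop ord0 i).
  by case: (A j i) => // a; case: (x ord0 i).
have kj : k != sh j by apply: contraTneq Sk => ->; rewrite Sj.
have := u_sharp j k jN kj; rewrite -ij.
move: (v_max k); rewrite /v.
move: (A_trop j i) Aj xi (x_trop ord0 i) (A_trop j k) (x_trop ord0 k) le_k.
case: (A j i) => // a; case: (x ord0 i) => // b.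
case: (A j k) => [a'| |] //; case: (x ord0 k) => [b'| |] //=.
rewrite -!EFinD !lee_fin lte_fin => _ _ _ _ _ _ le_k /(_ isT) le_v lt_u.
by move: le_k le_v lt_u; lra.
Qed.

(** A violated row has its negative entry as its unique minimiser. *)
Lemma no_neg_leaf_feasible (x : 'rV[\bar R]_d) : tropical_mx x ->
    (forall j i, ~~ neg_leaf Sigma (covector A x) i j) ->
  feasible_point A Sigma x.
Proof.
case: sys => A_trop sgn x_trop no_leaf; split=> // j.
apply/bigmin_geP; split=> [|i /eqP Sji]; first exact: leey.
rewrite leNgt; apply/negP => lt_i.
have /negP := no_leaf j i; apply; apply/(neg_leafP Sigma i j A_trop x_trop).
have Aji : A j i != +oo by apply/eqP => /(sgn j i).1; rewrite Sji.
have xi : x ord0 i != +oo.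
  apply: contraTneq lt_i => ->; rewrite -leNgt.
  by move: (A_trop j i); case: (A j i) => // *; apply: leey.
split=> // k ki; case Sjk: (Sigma j k).
- by apply: lt_le_trans lt_i _; apply: bigmin_le_cond; rewrite Sjk.
- by move: ki; rewrite -(shP Sji) -(shP Sjk) eqxx.
- rewrite (proj2 (sgn j k) Sjk) addye //.
  by move: Aji xi; case: (A j i) => // a _; case: (x ord0 i) => // *; apply: ltey.
Qed.
End Certificates.

(** * Runs of the procedure *)

Lemma Acc_measure (T : Type) (r : T -> T -> Prop) (P : T -> Prop) (m : T -> nat) :
    (forall s t, r s t -> P s -> P t /\ (m t < m s)%N) ->
  forall s, P s -> Acc (fun t s' => r s' t) s.
Proof.
move=> decr s; have [k] := ubnP (m s); elim: k s => [s|k IH s le_k Ps].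
  by rewrite ltn0.
apply: Acc_intro => t st; have [Pt lt_m] := decr s t st Ps.
exact: IH (leq_trans lt_m le_k) Pt.
Qed.

Lemma trimmed_shape (n d : nat) (Sigma : 'M[sign]_(n, d)) (delta : 'I_d) :
  trimmed Sigma ->
  exists sh : 'I_n -> 'I_d, forall j i, Sigma j i = Neg -> sh j = i.
Proof.
move=> trim; exists (fun j => odflt delta [pick i | Sigma j i == Neg]) => j i Sji.
case: pickP => [k Sjk|/(_ i)]; last by rewrite Sji.
by apply: (card_le1_eqP (trim j)); rewrite inE ?Sji.
Qed.

Section Runs.
Context (R : realType) (n d : nat) (A : 'M[\bar R]_(n, d))
  (Sigma : 'M[sign]_(n, d)).
Hypothesis sys : signed_system A Sigma.
Context (sh : 'I_n -> 'I_d).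
Hypothesis shP : forall j i, Sigma j i = Neg -> sh j = i.

Let A_trop : tropical_mx A := sys.1.

(** The invariant of a run.  The set [N] selects one negative apex for each
    coordinate of [D], and the sharp potential, which exists without being
    computed, plays the role of genericity. *)
Definition valid (D : {set 'I_d}) (N : {set 'I_n}) (delta : 'I_d) : Prop :=
  [/\ delta \notin D, {in N &, injective sh}, sh @: N = D,
      forall j, j \in N -> Sigma j (sh j) = Neg
    & exists u, sharp A sh N u].

Lemma neg_fin j i : Sigma j i = Neg -> A j i != +oo.
Proof. by move=> Sji; apply/eqP => /(sys.2 j i).1; rewrite Sji. Qed.

Section Valid.
Context (D : {set 'I_d}) (N : {set 'I_n}) (delta : 'I_d).
Hypothesis validN : valid D N delta.
Let x := cramer A N (delta |: D).

Lemma valid_cramer_trop : tropical_mx x.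
Proof.
by rewrite /x; case: validN => _ _ <- _ _ i j; rewrite (ord1 i); exact: cramer_trop.
Qed.

Lemma valid_delta_fin : x ord0 delta != +oo.
Proof.
rewrite /x; case: validN => dD inj ED neg [u u_sharp]; rewrite -ED in dD *.
by apply: cramer_delta_fin u_sharp => // j /neg/neg_fin.
Qed.

Lemma valid_potential j k : j \in N ->
  A j (sh j) + x ord0 (sh j) <= A j k + x ord0 k.
Proof.
rewrite /x; case: validN => dD inj ED neg [u u_sharp]; rewrite -ED in dD *.
move=> jN; apply: (cramer_potential A_trop inj dD _ u_sharp) => // l.
by move/neg/neg_fin.
Qed.

Lemma valid_tight j : j \in N -> x ord0 (sh j) != +oo ->
  exists2 k, k != sh j & A j k + x ord0 k <= A j (sh j) + x ord0 (sh j).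
Proof.
by rewrite /x; case: validN => _ _ <- _ _; apply: cramer_tight.
Qed.

(** A negative leaf can be added to the selected apices without losing sharpness,
    whether its shape is already in [D] or is [delta]; this one fact keeps the
    invariant in both kinds of moves. *)
Lemma valid_leaf i r : neg_leaf Sigma (cramer_covector A N (delta |: D)) i r ->
  [/\ sh r = i, r \notin N, i \in delta |: D & exists u, sharp A sh (r |: N) u].
Proof.
case/(neg_leafP Sigma i r A_trop valid_cramer_trop).
rewrite -/x => Sri Ari xi lt_k; have sri := shP Sri; split=> //.
- apply/negP => rN; rewrite -sri in xi lt_k.
  have [k kr] := valid_tight rN xi.
  by rewrite leNgt lt_k.
- by move: xi; rewrite /x mxE; case: ifP; rewrite ?eqxx.
- have [_ _ _ neg [u u_sharp]] := validN; rewrite -sri in Sri xi lt_k.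
  apply: (sharp_setU1 A_trop _ _ u_sharp valid_potential) => // [j|k].
    by rewrite !inE => /predU1P[->|/neg]; apply: neg_fin.
  exact: valid_cramer_trop.
Qed.

Lemma valid_twins r : r \notin N -> Sigma r (sh r) = Neg -> sh r \in D ->
  exists2 p, [set q in N | same_shape Sigma q r] = [set p] & p \in N /\ sh p = sh r.
Proof.
have [_ inj ED neg _] := validN; rewrite -ED => rN Sr /imsetP[p pN rp].
exists p => //; apply/setP => q; rewrite !inE; apply/andP/eqP => [[qN]|->].
  case/existsP=> i /andP[/eqP/shP qi /eqP/shP ri].
  by apply: inj; rewrite // qi -rp ri.
by split=> //; apply/existsP; exists (sh r); rewrite /has_shape {1}rp neg ?Sr.
Qed.

Lemma valid_pivot r p :
    pivot_apex Sigma D N (cramer_covector A N (delta |: D)) r ->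
    [set q in N | same_shape Sigma q r] = [set p] ->
  valid D (r |: (N :\ p)) delta.
Proof.
case/andP=> rN /exists_inP[i iD leaf] pE.
have [sri _ _ [u u_sharp]] := valid_leaf leaf.
have [Sri _ _ _] := (neg_leafP Sigma i r A_trop valid_cramer_trop).1 leaf.
rewrite -sri in Sri iD; have [p' pE' [pN pr]] := valid_twins rN Sri iD.
move: pE; rewrite pE' => /set1_inj e; subst p'.
have [dD inj ED neg _] := validN; split=> //.
- move=> a b; rewrite !inE => /predU1P[->|/andP[ap aN]] /predU1P[->|/andP[bp bN]] //.
  + by rewrite -pr => /inj e; rewrite e ?eqxx in bp.
  + by rewrite -pr => /inj e; rewrite e ?eqxx in ap.
  + exact: inj.
- rewrite imsetU1 -ED; apply/setP => k; rewrite !inE.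
  apply/predU1P/imsetP => [[->|]|[q qN ->]].
  + by exists p.
  + by case/imsetP=> q; rewrite inE => /andP[_ qN] ->; exists q.
  + have [->|qp] := eqVneq q p; [by left | right].
    by rewrite imset_f // !inE qp.
- by move=> j; rewrite !inE => /predU1P[->//|/andP[_ /neg]].
- exists u => j k; rewrite !inE => jN; apply: u_sharp; rewrite !inE.
  by case/predU1P: jN => [->|/andP[_ ->]]; rewrite ?eqxx ?orbT.
Qed.

(** When [delta] is blocked, the blocking apex gives [delta] a selected apex too,
    so that all of [delta |: D] is covered by shapes. *)
Lemma blocked_full j :
    neg_leaf Sigma (cramer_covector A N (delta |: D)) delta j ->
  [/\ {in j |: N &, injective sh}, sh @: (j |: N) = delta |: D,
    forall l, l \in j |: N -> Sigma l (sh l) = Neg & exists u, sharp A sh (j |: N) u].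
Proof.
move=> leaf; have [srj jN _ u_sharp] := valid_leaf leaf.
have [Sj _ _ _] := (neg_leafP Sigma delta j A_trop valid_cramer_trop).1 leaf.
have [dD inj ED neg _] := validN; rewrite -srj in dD *; split=> //.
- move=> a b; rewrite !inE => /predU1P[->|aN] /predU1P[->|bN] //; last exact: inj.
  + by move=> e; move: dD; rewrite e -ED imset_f.
  + by move=> e; move: dD; rewrite -e -ED imset_f.
- by rewrite imsetU1 ED.
- by move=> l; rewrite !inE => /predU1P[->|/neg//]; rewrite srj.
Qed.

Lemma valid_feasible :
    (forall r, ~~ pivot_apex Sigma D N (cramer_covector A N (delta |: D)) r) ->
    ~~ blocked Sigma delta (cramer_covector A N (delta |: D)) ->
  x != const_mx +oo /\ feasible_point A Sigma x.
Proof.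
move=> no_pivot no_block; split.
  by apply: contraNneq valid_delta_fin => ->; rewrite mxE.
apply: (no_neg_leaf_feasible sys shP valid_cramer_trop) => j i.
apply/negP => leaf; have [_ jN] := valid_leaf leaf.
rewrite !inE => /predU1P[di|iD] _.
  by case/negP: no_block; apply/existsP; exists j; rewrite di in leaf.
by case/negP: (no_pivot j); rewrite /pivot_apex jN; apply/exists_inP; exists i.
Qed.

Lemma valid_infeasible :
    blocked Sigma delta (cramer_covector A N (delta |: D)) -> #|D|.+1 = d ->
  infeasible A Sigma.
Proof.
case/existsP=> j /blocked_full[_ ED neg [u u_sharp]] Dd.
apply: (sharp_infeasible sys u_sharp neg); rewrite ED.
apply/eqP; rewrite eqEcard subsetT cardsT card_ord cardsU1.
by have [-> _ _ _ _] := validN; rewrite /= add1n Dd leqnn.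
Qed.

Lemma valid_card : #|N|.+1 = #|delta |: D|.
Proof. by have [dD inj ED _ _] := validN; rewrite cardsU1 dD -ED card_in_imset. Qed.

Lemma valid_step : exists t,
  step A Sigma (Running R D N delta (cramer_covector A N (delta |: D))) t.
Proof.
set y := cramer_covector _ _ _.
have [r pivot|no_pivot] := pickP (pivot_apex Sigma D N y).
  have /andP[rN /exists_inP[i iD leaf]] := pivot.
  have [sri _ _ _] := valid_leaf leaf.
  have [Sri _ _ _] := (neg_leafP Sigma i r A_trop valid_cramer_trop).1 leaf.
  rewrite -sri in iD Sri; have [p pE _] := valid_twins rN Sri iD.
  by eexists; apply: step_pivot pivot pE.
have {}no_pivot r : ~~ pivot_apex Sigma D N y r by rewrite no_pivot.
have [block|] := boolP (blocked Sigma delta y); last first.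
  by move=> no_block; eexists; apply: step_feasible.
have [Dd|Dd] := eqVneq #|D|.+1 d; first by eexists; apply: step_infeasible.
have /existsP[j leaf] := block; have [_ jN _ _] := valid_leaf leaf.
have [delta' d'] : exists delta', delta' \notin delta |: D.
  apply/existsP; apply: contraNT Dd; rewrite negb_exists => /forallP full.
  have -> : #|D|.+1 = #|delta |: D|.
    by have [dD _ _ _ _] := validN; rewrite cardsU1 dD.
  rewrite -[X in _ == X]card_ord -cardsT; apply/eqP; congr #|pred_of_set _|.
  by apply/setP => k; have := full k; rewrite negbK => ->; rewrite inE.
by eexists; apply: step_grow (elimN eqP Dd) jN leaf d'.
Qed.

End Valid.

Lemma valid_grow D N delta j delta' : valid D N delta ->
    neg_leaf Sigma (cramer_covector A N (delta |: D)) delta j ->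
  delta' \notin delta |: D -> valid (delta |: D) (j |: N) delta'.
Proof. by move=> vN /(blocked_full vN)[]. Qed.

Definition rel_cramer (E : {set 'I_d}) (delta : 'I_d) (N : {set 'I_n}) (i : 'I_d) :=
  cramer A N E ord0 i - cramer A N E ord0 delta.

Definition cramer_lt E delta (N N' : {set 'I_n}) :=
  [forall i, rel_cramer E delta N i <= rel_cramer E delta N' i] &&
  [exists i, rel_cramer E delta N i < rel_cramer E delta N' i].

Lemma cramer_lt_irr E delta N : ~~ cramer_lt E delta N N.
Proof.
by rewrite negb_and; apply/orP; right; apply/existsPn => i; rewrite ltxx.
Qed.

Lemma cramer_lt_trans E delta N1 N2 N3 :
  cramer_lt E delta N1 N2 -> cramer_lt E delta N2 N3 -> cramer_lt E delta N1 N3.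
Proof.
case/andP=> /forallP le12 /existsP[i lt12] /andP[/forallP le23 _].
apply/andP; split; first by apply/forallP => k; apply: le_trans (le12 k) (le23 k).
by apply/existsP; exists i; apply: lt_le_trans lt12 (le23 i).
Qed.

(** The number of sets above [N], a bound on the pivots still to come before
    [D] grows. *)
Definition rank E delta N := #|[set N' | cramer_lt E delta N N']|.

Lemma rank_max E delta N : (rank E delta N <= #|{set 'I_n}|)%N.
Proof. exact: max_card. Qed.

Lemma rank_lt E delta N N' : cramer_lt E delta N N' ->
  (rank E delta N' < rank E delta N)%N.
Proof.
move=> lt_N; apply/proper_card/properP; split.
  by apply/subsetP => M; rewrite !inE; apply: cramer_lt_trans.
by exists N'; rewrite inE // cramer_lt_irr.
Qed.

(** The old Cramer solution is a potential for the new set, strict at the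
    entering apex, while the new one is the greatest potential. *)
Lemma pivot_lt D N delta r p : valid D N delta ->
    pivot_apex Sigma D N (cramer_covector A N (delta |: D)) r ->
    [set q in N | same_shape Sigma q r] = [set p] ->
  cramer_lt (delta |: D) delta N (r |: (N :\ p)).
Proof.
move=> vN pivot pE; have [dD inj ED neg [u u_sharp]] := valid_pivot vN pivot pE.
case/andP: pivot => rN /exists_inP[i iD leaf].
have [Sri Ari xi lt_k] := (neg_leafP Sigma i r A_trop (valid_cramer_trop vN)).1 leaf.
have sri := shP Sri; rewrite -sri in Sri Ari xi lt_k.
set x := cramer A N (delta |: D) in xi lt_k.
have z_trop k : x ord0 k != -oo by exact: valid_cramer_trop.
have z_delta : x ord0 delta != +oo by exact: valid_delta_fin.
have z_pot j k : j \in r |: (N :\ p) ->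
    A j (sh j) + x ord0 (sh j) <= A j k + x ord0 k.
  rewrite !inE => /predU1P[->|/andP[_ jN]]; last exact: valid_potential.
  by have [->//|/lt_k/ltW] := eqVneq k (sh r).
have fin j : j \in r |: (N :\ p) -> A j (sh j) != +oo by move/neg/neg_fin.
rewrite /cramer_lt /rel_cramer -/x -ED; rewrite -ED in dD.
apply/andP; split.
  apply/forallP => k.
  exact: (cramer_greatest A_trop inj dD fin u_sharp z_trop z_delta z_pot).
apply/existsP; exists (sh r).
apply: (cramer_greatest_lt A_trop inj dD fin u_sharp z_trop z_delta z_pot) => //.
by rewrite !inE eqxx.
Qed.

(** The correctness of the answer is part of the invariant, because a returned
    state no longer remembers the data that certify it. *)
Definition state_inv (s : state R n d) : Prop :=
  match s with
  | Running D N delta y => valid D N delta /\ y = cramer_covector A N (delta |: D)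
  | Returned Feasible x => x != const_mx +oo /\ feasible_point A Sigma x
  | Returned Infeasible _ => infeasible A Sigma
  end.

(** Lexicographic in the size of [D] and the rank of [N]; ranks are at most
    [#|{set 'I_n}|], hence the factor. *)
Definition run_measure (s : state R n d) : nat :=
  if s is Running D N delta _ then
    ((d - #|D|) * #|{set 'I_n}|.+1 + rank (delta |: D) delta N).+1
  else 0%N.

Lemma start_inv delta : state_inv (start A delta).
Proof.
split; last by [].
split; rewrite ?imset0 ?inE //; try by move=> j; rewrite inE.
by exists (fun=> 0%R) => j k; rewrite inE.
Qed.

Lemma step_inv s t : step A Sigma s t -> state_inv s -> state_inv t.
Proof.
case=> /= {s t}.
- move=> D N delta y r p pivot pE [vN ey]; subst y; split=> //.
  exact: valid_pivot pE.
- by move=> D N delta y np nb [vN ey]; subst y; apply: valid_feasible.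
- by move=> D N delta y np nb Dd [vN ey]; subst y; exact: (valid_infeasible vN nb Dd).
- move=> D N delta y j delta' np nb Dd jN leaf d' [vN ey]; subst y; split=> //.
  exact: (valid_grow vN leaf).
Qed.

Lemma step_measure s t : step A Sigma s t -> state_inv s ->
  (run_measure t < run_measure s)%N.
Proof.
case=> /= {s t} //.
- move=> D N delta y r p pivot pE [vN ey]; subst y.
  by rewrite ltnS ltn_add2l; apply/rank_lt/pivot_lt.
- move=> D N delta y j delta' np nb Dd jN leaf d' [vN ey].
  have [dD _ _ _ _] := vN; rewrite ltnS cardsU1 dD add1n.
  have lt_D : (#|D| < d)%N.
    rewrite -[X in (_ < X)%N](card_ord d) -cardsT; apply/proper_card/properP.
    by split; [exact: subsetT | exists delta; rewrite ?inE].
  rewrite -(subnSK lt_D) mulSn; apply: leq_trans (leq_addr _ _).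
  by rewrite addSn ltnS addnC leq_add2r rank_max.
Qed.

Lemma inv_terminates s : state_inv s -> terminates_from A Sigma s.
Proof.
apply: (@Acc_measure _ _ state_inv run_measure) => {}s t st inv_s.
by split; [exact: step_inv st inv_s | exact: step_measure].
Qed.

End Runs.

Lemma reachable_inv (R : realType) (n d : nat) (A : 'M[\bar R]_(n, d))
    (Sigma : 'M[sign]_(n, d)) (s : state R n d) :
    signed_system A Sigma -> trimmed Sigma -> reachable A Sigma s ->
  exists2 sh : 'I_n -> 'I_d, (forall j i, Sigma j i = Neg -> sh j = i) &
    state_inv A Sigma sh s.
Proof.
move=> sys trim; elim=> [delta|{}s t _ [sh shP inv_s] st].
  by have [sh shP] := trimmed_shape delta trim; exists sh => //; apply: start_inv.
by exists sh => //; apply: (step_inv sys shP st inv_s).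
Qed.

End FindWitness.

Theorem theorem76 (R : realType) (n d : nat)
    (A : 'M[\bar R]_(n, d)) (Sigma : 'M[sign]_(n, d)) :
  signed_system A Sigma ->
  trimmed Sigma ->
  (* every run is finite, whatever choices are made *)
  (forall delta : 'I_d, terminates_from A Sigma (start A delta)) /\
  (* no run gets stuck before returning; y is always the covector graph of
     (N, D u {delta}), with |N| = |D u {delta}| - 1 as Cramer requires *)
  (forall (D : {set 'I_d}) (N : {set 'I_n}) (delta : 'I_d)
      (y : {set 'I_d * 'I_n}),
    reachable A Sigma (Running R D N delta y) ->
    #|N|.+1 = #|(delta |: D)%SET| /\
    y = cramer_covector A N (delta |: D)%SET /\
    exists t, step A Sigma (Running R D N delta y) t) /\
  (* the returned answer is correct *)
  (forall x : 'rV[\bar R]_d,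
    reachable A Sigma (Returned n Feasible x) ->
    x != const_mx +oo%E /\ feasible_point A Sigma x /\ feasible A Sigma) /\
  (forall x : 'rV[\bar R]_d,
    reachable A Sigma (Returned n Infeasible x) ->
    infeasible A Sigma).
Proof.
move=> sys trim; split; [|split; [|split]].
- move=> delta; have [sh shP] := trimmed_shape delta trim.
  by apply: (inv_terminates sys shP); apply: start_inv.
- move=> D N delta y /(reachable_inv sys trim)[sh shP [vN ->]].
  split; first exact: valid_card vN.
  by split=> //; apply: (valid_step sys shP vN).
- move=> x /(reachable_inv sys trim)[sh shP [x_nz x_feas]].
  by split=> //; split=> //; exists x.
- by move=> x /(reachable_inv sys trim)[sh shP].
Qed.
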